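(* Every nilpotent-by-finite group is bounded FC-nilpotent. That is, if a group $H$ has a normal nilpotent subgroup of finite index, then $H$ is bounded FC-nilpotent of class $n$ for some natural number $n$.
   Context: Let $H$ be a group, $N$ a normal subgroup of $H$ and $g\in H$. Write $C_H(g/N)$ for the preimage in $H$ of the centralizer $C_{H/N}(gN)$ under the projection $H\to H/N$, i.e. $C_H(g/N)=\{h\in H : [g,h]\in N\}$. For a subgroup $K$ of $H$, the FC-centralizer of $H$ modulo $N$ in $K$ is $$\mathrm{FC}_K(H/N)=\{k\in K : [H:C_H(k/N)] \text{ is finite}\}.$$ It is called bounded if there exists a natural number $m$ such that $\mathrm{FC}_K(H/N)=\{k\in K : [H:C_H(k/N)]\le m\}$. A group $H$ is FC-nilpotent of class $n$ if there is a finite chain $\{1\}=H_0\le H_1\le\dots\le H_n=H$ of normal subgroups of $H$ such that $H_{i+1}\le \mathrm{FC}_H(H/H_i)$ for every $0\le i<n$. It is bounded FC-nilpotent of class $n$ if there is such a chain for which, additionally, each $\mathrm{FC}_{H_{i+1}}(H/H_i)$ ($0\le i<n$) is bounded. (Equivalently: for each $i<n$ there is a natural number $m_i$ with $[H:C_H(h/H_i)]\le m_i$ for all $h\in H_{i+1}$.) A group is bounded FC-nilpotent if it is so of some class $n$. *)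

(* Defs.v *)
From mathcomp Require Import all_boot.
From mathcomp Require Import all_classical.

Set Implicit Arguments.
Unset Strict Implicit.
Unset Printing Implicit Defensive.

Local Open Scope classical_set_scope.
Local Open Scope card_scope.
Local Open Scope group_scope.

(* [groupType] includes a choice operator on the carrier; every type has one
   by the classical axioms of [boolp], so this does not restrict the groups
   considered.  The ambient group H is the whole type, i.e. the set [setT]. *)

Definition subgroup (H : groupType) (K : set H) : Prop :=
  K 1 /\ forall x y : H, K x -> K y -> K (x / y).

Definition normal_subgroup (H : groupType) (N : set H) : Prop :=
  subgroup N /\ forall x g : H, N x -> N (x ^ g).

Definition left_cosets (H : groupType) (K : set H) : set (set H) :=
  range (fun x : H => [set x * k | k in K]).

Definition finite_index (H : groupType) (K : set H) : Prop :=
  finite_set (left_cosets K).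

Definition index_le (H : groupType) (K : set H) (m : nat) : Prop :=
  left_cosets K #<= `I_m.

(* C_H(g/N) *)
Definition centralizer_mod (H : groupType) (N : set H) (g : H) : set H :=
  [set h | N [~ g, h]].

(* FC_K(H/N) *)
Definition FC_centralizer (H : groupType) (K N : set H) : set H :=
  [set k | K k /\ finite_index (centralizer_mod N k)].

Definition bounded_FC_centralizer (H : groupType) (K N : set H) : Prop :=
  exists m : nat,
    FC_centralizer K N = [set k | K k /\ index_le (centralizer_mod N k) m].

(* Only the values G 0, ..., G n of the sequence G matter. *)
Definition FC_chain (H : groupType) (n : nat) (G : nat -> set H) : Prop :=
  [/\ G 0 = [set 1],
      G n = setT,
      forall i, (i <= n)%N -> normal_subgroup (G i),
      forall i, (i < n)%N -> G i `<=` G i.+1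
    & forall i, (i < n)%N -> G i.+1 `<=` FC_centralizer setT (G i)].

Definition FC_nilpotent_of_class (H : groupType) (n : nat) : Prop :=
  exists G : nat -> set H, FC_chain n G.

Definition bounded_FC_nilpotent_of_class (H : groupType) (n : nat) : Prop :=
  exists G : nat -> set H,
    FC_chain n G /\
    forall i, (i < n)%N -> bounded_FC_centralizer (G i.+1) (G i).

Definition bounded_FC_nilpotent (H : groupType) : Prop :=
  exists n : nat, bounded_FC_nilpotent_of_class H n.

(* [smallest] is the intersection of all subgroups containing the set, so this
   is the subgroup [A, B] generated by the commutators. *)
Definition commutator_subgroup (H : groupType) (A B : set H) : set H :=
  smallest (@subgroup H) [set [~ a, b] | a in A & b in B].

Fixpoint lower_central_series (H : groupType) (K : set H) (n : nat) : set H :=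
  if n is n'.+1 then commutator_subgroup (lower_central_series K n') K else K.

Definition nilpotent_subgroup (H : groupType) (K : set H) : Prop :=
  subgroup K /\ exists n : nat, lower_central_series K n = [set 1].

Definition nilpotent_by_finite (H : groupType) : Prop :=
  exists N : set H,
    [/\ normal_subgroup N, nilpotent_subgroup N & finite_index N].

(* Main.v *)
Require Import Defs.
From mathcomp Require Import all_boot.
From mathcomp Require Import all_classical.

Set Implicit Arguments.
Unset Strict Implicit.
Unset Printing Implicit Defensive.

Local Open Scope classical_set_scope.
Local Open Scope card_scope.
Local Open Scope group_scope.

(* If N is nilpotent of class c, normal and of finite index in H, refine
   1 <= N <= H by the lower central series of N.  Elements of N centralize
   each factor of the series, and they centralize every element of H modulo N;
   so in every step the centralizers contain N and have index at most [H:N]. *)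

Section Subgroups.
Variable H : groupType.
Implicit Types (K L M N : set H) (g x y : H).

Lemma subgroupV K x : subgroup K -> K x -> K x^-1.
Proof. by case=> K1 KB Kx; rewrite -[x^-1]mul1g; exact: KB. Qed.

Lemma subgroupM K x y : subgroup K -> K x -> K y -> K (x * y).
Proof.
move=> sK Kx Ky; rewrite -[y]invgK; apply: (proj2 sK) => //.
exact: subgroupV.
Qed.

Lemma normal_subgroupT : normal_subgroup [set: H].
Proof. by []. Qed.

Lemma normal_commg N x g : normal_subgroup N -> N x -> N [~ x, g].
Proof.
move=> [sN JN] Nx; rewrite commgEl.
by apply: subgroupM => //; [exact: subgroupV | exact: JN].
Qed.

Lemma normal_commg_r N x g : normal_subgroup N -> N x -> N [~ g, x].
Proof.
move=> nN Nx; rewrite -invgR; apply: subgroupV; first by case: nN.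
exact: normal_commg.
Qed.

Lemma subgroup_smallest (A : set H) : subgroup (smallest (@subgroup H) A).
Proof.
split=> [K [[K1 _] _]//|x y Ax Ay K KA].
by case: (KA) => [[_ KB] _]; apply: KB; [exact: Ax | exact: Ay].
Qed.

Lemma commutator_subgroup_mem K L x y :
  K x -> L y -> commutator_subgroup K L [~ x, y].
Proof. by move=> Kx Ly M [_]; apply; exists x => //; exists y. Qed.

Lemma normal_commutator_subgroup K L :
  normal_subgroup K -> normal_subgroup L ->
  normal_subgroup (commutator_subgroup K L).
Proof.
move=> [_ JK] [_ JL]; have sC := subgroup_smallest [set [~ a, b] | a in K & b in L].
split=> // x g Cx.
(* Elements of [smallest] lie in every subgroup containing the generators; the one used here
   consists of the [y] whose conjugate by [g] falls in the commutator subgroup. *)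
apply: (Cx [set y | commutator_subgroup K L (y ^ g)]); split.
  split=> [|y z Cy Cz] /=; first by rewrite conj1g; case: sC.
  by rewrite conjMg conjVg; apply: (proj2 sC).
move=> _ [a Ka [b Lb <-]] /=; rewrite conjRg.
by apply: commutator_subgroup_mem; [exact: JK | exact: JL].
Qed.

(** By normality [K] is itself a subgroup containing all the generating commutators. *)
Lemma commutator_subgroup_subl K L :
  normal_subgroup K -> commutator_subgroup K L `<=` K.
Proof.
move=> nK x; apply; split; first by case: nK.
by move=> _ [a Ka [b _ <-]]; exact: normal_commg.
Qed.

Lemma normal_lower_central_series N n :
  normal_subgroup N -> normal_subgroup (lower_central_series N n).
Proof. by move=> nN; elim: n => //= n IH; exact: normal_commutator_subgroup. Qed.

Lemma subgroup_centralizer_mod N g :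
  normal_subgroup N -> subgroup (centralizer_mod N g).
Proof.
move=> [sN JN]; split=> [|x y Cx Cy]; rewrite /centralizer_mod /=.
  by rewrite commg1; case: sN.
(* The commutator with a quotient is a quotient of commutators up to conjugation by [y^-1], which
   the normal subgroup [N] absorbs. *)
have -> : [~ g, x / y] = ([~ g, y]^-1 * [~ g, x]) ^ y^-1.
  by rewrite invgR /commg !conjgE !invgM !invgK !mulgA mulgV mul1g mulgK.
by apply: JN; apply: subgroupM => //; exact: subgroupV.
Qed.

(** The map sending a coset [C] to the product set [C L] takes [x K] to [x L], hence maps the cosets
    of [K] onto those of [L]. *)
Lemma left_cosets_sub_le K L :
  subgroup K -> subgroup L -> K `<=` L -> left_cosets L #<= left_cosets K.
Proof.
move=> [K1 _] sL KL.
suff -> : left_cosets L =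
    (fun C : set H => [set c * l | c in C & l in L]) @` left_cosets K.
  exact: card_image_le.
rewrite /left_cosets image_comp; apply: eq_imagel => x _ /=.
apply/seteqP; split=> [_ [l Ll <-]|_ [_ [k Kk <-] [l Ll <-]]].
  by exists x; [exists 1; rewrite ?mulg1 | exists l].
by exists (k * l); [apply: subgroupM => //; exact: KL | rewrite mulgA].
Qed.

Lemma finite_indexP K : finite_index K <-> exists m, index_le K m.
Proof. exact: finite_set_leP. Qed.

Lemma index_le_sub K L m :
  subgroup K -> subgroup L -> K `<=` L -> index_le K m -> index_le L m.
Proof. by move=> sK sL KL; apply: card_le_trans; exact: left_cosets_sub_le. Qed.

(** One bound [m] for all steps serves twice: it makes each index finite, as the chain requires, and
    it makes both sides of each boundedness equation equal to [G i.+1]. *)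
Lemma FC_chain_bounded n m (G : nat -> set H) :
  [/\ G 0 = [set 1], G n = setT,
      forall i, (i <= n)%N -> normal_subgroup (G i) &
      forall i, (i < n)%N -> G i `<=` G i.+1] ->
  (forall i x, (i < n)%N -> G i.+1 x -> index_le (centralizer_mod (G i) x) m) ->
  bounded_FC_nilpotent_of_class H n.
Proof.
move=> [G0 Gn nG GS] Gm; exists G; split.
  split=> // i ltin x Gx; split=> //; apply/finite_indexP; exists m; exact: Gm.
move=> i ltin; exists m; apply/seteqP; split=> x [Gx _]; split=> //.
  exact: Gm.
by apply/finite_indexP; exists m; exact: Gm.
Qed.

End Subgroups.

Theorem mainTheorem2 (H : groupType) :
  nilpotent_by_finite H -> bounded_FC_nilpotent H.
Proof.
move=> [N [nN [sN [c Nc]] /finite_indexP[m Nm]]].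
(* The lower central series is indexed from [N] at 0 down to 1 at [c]. Reversed, it climbs from
   [G 0 = 1] to [G c = N]; one more step reaches the whole group, so the class is [c.+1]. *)
pose G i := if (i <= c)%N then lower_central_series N (c - i) else setT.
have nG i : normal_subgroup (G i).
  rewrite /G; case: ifP => _; last exact: normal_subgroupT.
  exact: normal_lower_central_series.
have GS i : (i < c)%N -> G i = commutator_subgroup (G i.+1) N.
  by move=> ltic; rewrite /G ltic ltnW // -[in LHS](subnSK ltic).
have Gc : G c = N by rewrite /G leqnn subnn.
exists c.+1; apply: (@FC_chain_bounded _ _ m G).
  split=> [||i _|i]; rewrite ?ltnS.
  - by rewrite /G subn0.
  - by rewrite /G ltnn.
  - exact: nG.
  - rewrite leq_eqVlt => /predU1P[->|ltic]; first by rewrite [G c.+1]/G ltnn.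
    by rewrite GS //; apply: commutator_subgroup_subl; exact: nG.
move=> i x; rewrite ltnS => leic Gx.
(* It remains to see that [N] lies in the centralizer of [x] modulo [G i]. *)
apply: index_le_sub Nm => //; first exact: subgroup_centralizer_mod.
move=> y Ny; rewrite /centralizer_mod /=.
move: leic; rewrite leq_eqVlt => /predU1P[->|ltic].
  (* Top step: [x] is arbitrary in [H], and normality of [N] puts the commutator in [N]. *)
  by rewrite Gc; exact: normal_commg_r.
(* Lower steps: the commutator is one of the generators of [G i]. *)
by rewrite GS //; exact: commutator_subgroup_mem.
Qed.
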